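(* Let $\varphi = \frac{1+\sqrt{5}}{2}$ be the golden ratio. The group $GG_5(r)$ is infinite at $r=\sqrt{3+\varphi}$.
   Context: For an integer $n\geq 2$ and a real radius $r>0$, let $D_1$ and $D_2$ be the closed disks of radius $r$ in the Euclidean plane $\mathbb{R}^2$ centered at $(-1,0)$ and $(1,0)$ respectively. Let $a:\mathbb{R}^2\to\mathbb{R}^2$ be the bijection that rotates every point of $D_1$ about $(-1,0)$ by the angle $-2\pi/n$ (i.e. clockwise by $2\pi/n$) and fixes every point outside $D_1$. Let $b:\mathbb{R}^2\to\mathbb{R}^2$ be the bijection that rotates every point of $D_2$ about $(1,0)$ by the angle $-2\pi/n$ and fixes every point outside $D_2$. The two-disk compound symmetry group $GG_n(r)$ is the group of bijections of the plane generated by $a$ and $b$ under composition, with products read left to right: $(ab)(x)=b(a(x))$. *)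

(* Defs.v *)
From HB Require Import structures.
From mathcomp Require Import all_boot all_order all_algebra.
From mathcomp Require Import all_classical all_reals all_analysis.
From mathcomp Require Import ring lra.

Set Implicit Arguments.
Unset Strict Implicit.
Unset Printing Implicit Defensive.

Import Order.TTheory GRing.Theory Num.Theory.
Local Open Scope classical_set_scope.
Local Open Scope ring_scope.

Record bijection (T : Type) :=
  Bijection { bijection_fun :> T -> T; bijectionP : bijective bijection_fun }.

HB.instance Definition _ (T : Type) := gen_eqMixin (bijection T).
HB.instance Definition _ (T : Type) := gen_choiceMixin (bijection T).

Section BijectionGroup.
Variable T : Type.
Implicit Types f g h : bijection T.

Lemma bijection_ext f g : f =1 g -> f = g.
Proof.
case: f g => [f fP] [g gP] /= /funext fg; rewrite {}fg in fP *.
by congr Bijection; exact: Prop_irrelevance.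
Qed.

Lemma bijection_inverse f :
  exists g, cancel f g /\ cancel g f.
Proof.
have [g fK gK] := bijectionP f.
by exists (Bijection (Bijective gK fK)).
Qed.

Definition bijection_one : bijection T := @Bijection T id (inv_bij (fun=> erefl)).

(* Products are read left to right: [f * g] first applies [f]. *)
Definition bijection_mul f g : bijection T :=
  Bijection (bij_comp (bijectionP g) (bijectionP f)).

Definition bijection_inv f : bijection T := projT1 (cid (bijection_inverse f)).

Lemma bijection_invK f : cancel f (bijection_inv f).
Proof. by rewrite /bijection_inv; case: cid => g []. Qed.

Lemma bijection_invKV f : cancel (bijection_inv f) f.
Proof. by rewrite /bijection_inv; case: cid => g []. Qed.

Lemma bijection_mulA : associative bijection_mul.
Proof. by move=> f g h; exact: bijection_ext. Qed.

Lemma bijection_mul1 : left_id bijection_one bijection_mul.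
Proof. by move=> f; exact: bijection_ext. Qed.

Lemma bijection_mulr1 : right_id bijection_one bijection_mul.
Proof. by move=> f; exact: bijection_ext. Qed.

Lemma bijection_mulV : left_inverse bijection_one bijection_inv bijection_mul.
Proof. by move=> f; apply: bijection_ext; exact: bijection_invKV. Qed.

Lemma bijection_mulrV : right_inverse bijection_one bijection_inv bijection_mul.
Proof. by move=> f; apply: bijection_ext; exact: bijection_invK. Qed.

End BijectionGroup.

HB.instance Definition _ (T : Type) := isGroup.Build (bijection T)
  (@bijection_mulA T) (@bijection_mul1 T) (@bijection_mulr1 T)
  (@bijection_mulV T) (@bijection_mulrV T).

Definition generated_subgroup (G : groupType) (S : set G) : set G :=
  smallest [set M : set G | group_closed (mem M)] S.

Lemma sub_generated_subgroup (G : groupType) (S : set G) :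
  S `<=` generated_subgroup S.
Proof. exact: sub_gen_smallest. Qed.

Lemma generated_subgroup_closed (G : groupType) (S : set G) :
  group_closed (mem (generated_subgroup S)).
Proof.
split=> [|x y]; first by rewrite inE => M [[]]; rewrite inE.
rewrite !inE => xS yS M MS; have [[_ MB] _] := MS.
by apply/set_mem/MB; apply/mem_set; [exact: xS|exact: yS].
Qed.

Section DiskRotation.
Variable R : realType.
Implicit Types (c x : R * R) (r t : R).

(* The canonical norm on [R * R] is the sup norm, hence this explicit
   Euclidean distance. *)
Definition euclidean_dist c x : R :=
  Num.sqrt ((x.1 - c.1) ^+ 2 + (x.2 - c.2) ^+ 2).

Definition closed_disk c r : set (R * R) := [set x | euclidean_dist c x <= r].

(* Counterclockwise for [t > 0]. *)
Definition rotation c t x : R * R :=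
  (c.1 + (cos t * (x.1 - c.1) - sin t * (x.2 - c.2)),
   c.2 + (sin t * (x.1 - c.1) + cos t * (x.2 - c.2))).

Definition disk_rotation_fun c r t x : R * R :=
  if x \in closed_disk c r then rotation c t x else x.

Lemma rotationK c t : cancel (rotation c t) (rotation c (- t)).
Proof.
case: c => c1 c2 [x1 x2]; rewrite /rotation /= cosN sinN.
have cs := cos2Dsin2 t.
congr pair.
- transitivity (c1 + (cos t ^+ 2 + sin t ^+ 2) * (x1 - c1)); first by ring.
  by rewrite cs; ring.
- transitivity (c2 + (cos t ^+ 2 + sin t ^+ 2) * (x2 - c2)); first by ring.
  by rewrite cs; ring.
Qed.

Lemma euclidean_dist_rotation c t x :
  euclidean_dist c (rotation c t x) = euclidean_dist c x.
Proof.
rewrite /euclidean_dist /rotation /=; congr Num.sqrt.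
transitivity ((cos t ^+ 2 + sin t ^+ 2) *
  ((x.1 - c.1) ^+ 2 + (x.2 - c.2) ^+ 2)); first by ring.
by rewrite cos2Dsin2 mul1r.
Qed.

Lemma rotation_closed_disk c r t x :
  (rotation c t x \in closed_disk c r) = (x \in closed_disk c r).
Proof.
by apply/idP/idP; rewrite !inE /closed_disk /= euclidean_dist_rotation.
Qed.

Lemma disk_rotation_funK c r t :
  cancel (disk_rotation_fun c r t) (disk_rotation_fun c r (- t)).
Proof.
move=> x; rewrite /disk_rotation_fun.
case xD: (x \in closed_disk c r); last by rewrite xD.
by rewrite rotation_closed_disk xD rotationK.
Qed.

Lemma disk_rotation_fun_bij c r t : bijective (disk_rotation_fun c r t).
Proof.
exists (disk_rotation_fun c r (- t)); first exact: disk_rotation_funK.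
by rewrite -{2}(opprK t); exact: disk_rotation_funK.
Qed.

Definition disk_rotation c r t : bijection (R * R) :=
  Bijection (disk_rotation_fun_bij c r t).

End DiskRotation.

Section TwoDiskGroup.
Variable R : realType.

(* Meant for [2 <= n] and [0 < r]; the angle is negative, i.e., clockwise. *)
Definition GG_a (n : nat) (r : R) : bijection (R * R) :=
  disk_rotation (-1, 0) r (- (2 * pi / n%:R)).

Definition GG_b (n : nat) (r : R) : bijection (R * R) :=
  disk_rotation (1, 0) r (- (2 * pi / n%:R)).

Definition GG (n : nat) (r : R) : set (bijection (R * R)) :=
  generated_subgroup [set GG_a n r; GG_b n r].

Definition golden_ratio : R := (1 + Num.sqrt 5) / 2.

End TwoDiskGroup.

Arguments golden_ratio {R}.

(* Main.v *)
Require Import Defs.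
From mathcomp Require Import all_boot all_order all_algebra.
From mathcomp Require Import all_classical all_reals all_analysis.
From mathcomp Require Import ring lra.
Import Order.TTheory GRing.Theory Num.Theory.
Local Open Scope classical_set_scope.
Local Open Scope ring_scope.

Set Implicit Arguments.
Unset Strict Implicit.
Unset Printing Implicit Defensive.

(** Write phi for the golden ratio, zeta for exp (2 i pi / 5), identify the
plane with the complex numbers and put E = zeta - zeta^2. The radius is chosen
so that |E + 1| = r: the end E of the segment [-E, E] lies on the circle around
-1, and its end -E on the circle around 1. A few words in a and b move pieces
of this segment while staying inside the disks they rotate, and bring them back
to the segment as translates:

- a b a b^2 moves t E to (t + 2 (phi - 1)) E for 1 - phi <= t <= 3 - 2 phi;
- the reflection z -> - z exchanges the two disks, so b a b a^2 translates by
  the opposite vector on the opposite piece, and its inverse moves t E to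
  (t + 2 (phi - 1)) E for -1 <= t <= 1 - phi;
- a b a and b a b map two overlapping pieces of the segment, which differ by
  a translation, to the same place, so a b a (b a b)^-1 moves t E to
  (t + 2 (phi - 1) - 2) E for 3 - 2 phi <= t <= 1.

Hence each point of the segment shares its orbit with its image under
t -> t + 2 (phi - 1) modulo 2 ([same_orbit_shift_right],
[same_orbit_shift_left]), an exchange of two intervals that is a rotation of
a circle. As phi is irrational ([golden_ratio_irrational]), the orbit of the
midpoint is infinite, and a group with an infinite orbit is infinite
([infinite_orbit]). *)

(** * The golden ratio and the angle 2 pi / 5 *)

Section GoldenRatio.
Variable R : realType.
Local Notation phi := (golden_ratio : R).

Lemma golden_ratio_sqr : phi * phi = phi + 1.
Proof.
have q2 : Num.sqrt 5 * Num.sqrt 5 = 5 :> R by rewrite -expr2 sqr_sqrtr.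
by rewrite /golden_ratio; field: q2.
Qed.

Lemma golden_ratio_bounds : 8 / 5 < phi < 5 / 3.
Proof.
have q2 : Num.sqrt 5 * Num.sqrt 5 = 5 :> R by rewrite -expr2 sqr_sqrtr.
have q0 : 0 <= Num.sqrt 5 :> R by exact: sqrtr_ge0.
by rewrite /golden_ratio; apply/andP; split; nra.
Qed.

(** The exponent of 5 is even in a nonzero square and odd in five times one. *)
Lemma sqr_eq_5sqr (a b : nat) : (a ^ 2 = 5 * b ^ 2 -> b = 0)%N.
Proof.
case: (posnP b) => // b0 ab; exfalso.
move/(congr1 (fun n => odd (logn 5 n))): ab.
by rewrite lognM ?expn_gt0 ?b0// !lognX oddD !oddM.
Qed.

(** Clearing the denominator of phi = (1 + sqrt 5) / 2 turns k phi = l into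
(2 l - k)^2 = 5 k^2. *)
Lemma golden_ratio_irrational (k l : int) : k%:~R * phi = l%:~R -> k = 0.
Proof.
move=> kl; have phi2 := golden_ratio_sqr.
have : (2 * l - k) ^+ 2 = 5 * k ^+ 2.
  apply: (@intr_inj R); rewrite !(rmorphXn, rmorphM, rmorphB)/= -kl.
  by ring: phi2.
move/(congr1 absz); rewrite abszM !abszX => /sqr_eq_5sqr/eqP.
by rewrite absz_eq0 => /eqP.
Qed.

(** The angle x = 2 pi / 5 satisfies cos (3 x) = cos (2 x), a cubic equation in
cos x with roots 1, (phi - 1) / 2 and - phi / 2; as x is acute, cos x lies
strictly between 0 and 1. *)
Lemma cos_two_pi5 : cos (2 * pi / 5) = (phi - 1) / 2 :> R.
Proof.
set x := 2 * pi / 5; have xE : x = 2 * pi / 5 by [].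
have pi0 := pi_gt0 R.
have x0 : 0 < x by lra.
have x1 : x < pi / 2 by lra.
have s0 : 0 < sin x by apply: sin_gt0_pihalf; rewrite x0 x1.
have c0 : 0 < cos x by apply: cos_gt0_pihalf; apply/andP; split; lra.
have cs := cos2Dsin2 x.
have : cos (x *+ 2 + x) = cos (x *+ 2).
  have -> : x *+ 2 + x = - (x *+ 2) + pi *+ 2 by rewrite xE; field.
  by rewrite cosD2pi cosN.
rewrite cosD cos_mulr2n sin_mulr2n => triple.
have s2 : sin x * sin x = 1 - cos x * cos x by rewrite -!expr2; lra.
have phi2 := golden_ratio_sqr; have /andP[phi0 _] := golden_ratio_bounds.
have /eqP : (cos x - 1) * ((cos x - (phi - 1) / 2) * (cos x + phi / 2)) = 0.
  have cs2 : cos x * (sin x * sin x) = cos x * (1 - cos x * cos x) by rewrite s2.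
  have phi2c : phi * phi * cos x = (phi + 1) * cos x by rewrite phi2.
  by lra.
rewrite !mulf_eq0 => /or3P[]/eqP h; [nra|lra|lra].
Qed.

Lemma sin_two_pi5_sqr : sin (2 * pi / 5) * sin (2 * pi / 5) = (2 + phi) / 4 :> R.
Proof.
have phi2 := golden_ratio_sqr.
by rewrite -expr2 sin2cos2 cos_two_pi5; field: phi2.
Qed.

End GoldenRatio.

(** * Orbits of a group of bijections *)

Section Orbits.
Variable T : Type.
Variable S : set (bijection T).

Definition same_orbit (x y : T) : Prop :=
  exists2 f, generated_subgroup S f & f x = y.

Lemma same_orbit_refl x : same_orbit x x.
Proof.
exists 1%g => //; have [S1 _] := generated_subgroup_closed S.
by move: S1; rewrite inE.
Qed.

Lemma same_orbit_sym x y : same_orbit x y -> same_orbit y x.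
Proof.
case=> f fS <-; exists (f^-1)%g; last exact: bijection_invK.
have [S1 SB] := generated_subgroup_closed S.
have := SB 1%g f; rewrite !inE div1g; apply=> //.
by move: S1; rewrite inE.
Qed.

Lemma same_orbit_trans x y z :
  same_orbit x y -> same_orbit y z -> same_orbit x z.
Proof.
case=> f fS fx /same_orbit_sym[g gS gz]; exists (f / g)%g.
  have [S1 SB] := generated_subgroup_closed S.
  by have := SB f g; rewrite !inE; apply.
by rewrite /= fx -gz bijection_invK.
Qed.

Lemma same_orbit_gen f x : S f -> same_orbit x (f x).
Proof. by exists f => //; exact: sub_generated_subgroup. Qed.

Lemma infinite_orbit (x : T) (y : nat -> T) :
  injective y -> (forall n, same_orbit x (y n)) ->
  infinite_set (generated_subgroup S).
Proof.
move=> yI xy S_fin; apply: infinite_nat.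
have orbit_fin := finite_image (fun f : bijection T => f x) S_fin.
have -> : [set: nat] = y @^-1` ((fun f : bijection T => f x) @` generated_subgroup S).
  by apply/seteqP; split=> // n _ /=; have [f fS <-] := xy n; exists f.
by apply: finite_preimage => // m n _ _; exact: yI.
Qed.

End Orbits.

(** * Moving the segment by the two rotations *)

Section Segment.
Variable R : realType.
Local Notation phi := (golden_ratio : R).
Let r : R := Num.sqrt (3 + phi).
Local Notation reach := (same_orbit [set GG_a 5 r; GG_b 5 r]).
Let phi2 := golden_ratio_sqr R.

(** Both rotations act on such points by formulas with coefficients in the field
generated by phi: only the square of the sine, [sin_two_pi5_sqr], enters. *)
Definition point (u w : R) : R * R := (u, sin (2 * pi / 5) * w).

(** Since k is 1 or -1, this is one application of [GG_b] or [GG_a] to a point of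
its disk. The sign k is a parameter so that a word and its mirror image under
z -> - z are handled together. *)
Lemma same_orbit_turn (k u w u' w' : R) : k * k = 1 ->
    (u - k) ^+ 2 + (2 + phi) / 4 * w ^+ 2 <= 3 + phi ->
    u' = k + (phi - 1) / 2 * (u - k) + (2 + phi) / 4 * w ->
    w' = (phi - 1) / 2 * w - (u - k) ->
  reach (point u w) (point u' w').
Proof.
rewrite -(sin_two_pi5_sqr R) => k2 in_disk -> ->.
have dr : euclidean_dist (k, 0) (point u w) <= r.
  rewrite /euclidean_dist /r ler_wsqrtr//= (le_trans _ in_disk)//.
  by rewrite subr0 exprMn expr2 lexx.
set x' := point (k + _ + _) _.
have -> : x' = disk_rotation (k, 0) r (- (2 * pi / 5)) (point u w).
  rewrite /= /disk_rotation_fun mem_set// /rotation /= cosN sinN cos_two_pi5.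
  by rewrite /x' /point; congr pair; ring.
apply: same_orbit_gen => /=.
by move/eqP: k2; rewrite -expr2 sqrf_eq1 => /orP[]/eqP ->; [right|left].
Qed.

(** This is t E with E = zeta - zeta^2, as cos (2 pi / 5) = (phi - 1) / 2,
cos (4 pi / 5) = - phi / 2 and
sin (4 pi / 5) = (phi - 1) sin (2 pi / 5). *)
Definition segment (t : R) : R * R := point ((phi - 1 / 2) * t) ((2 - phi) * t).

(** The word a b a for e = 1, and b a b for e = -1. Along a segment parametrized
by t, the gap between r^2 and the squared distance to a center is a quadratic
polynomial in t with leading coefficient - |E|^2 = phi - 3. It factors here
because an end of the piece, or of a segment extending it, is on the circle at
each step: t = 1 at the first, t = 1 - phi at the third, both at the second. *)
Lemma same_orbit_three_turns (e t : R) : e * e = 1 -> 1 - phi <= t <= 1 ->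
  reach (segment (e * t))
    (point (e * ((3 * phi - 4) / 2 - (phi - 1 / 2) * t))
           (e * (3 * phi - 5 + (2 - phi) * t))).
Proof.
move=> e2 /andP[t0 t1]; have /andP[phi0 phi1] := golden_ratio_bounds R.
apply: (@same_orbit_trans _ _ _
  (point (e * ((phi - 3) / 2 + (3 - phi) / 2 * t)) (e * (-1 - t)))).
  apply: (@same_orbit_turn (- e)); [by rewrite mulrNN| |by field: e2 phi2|by field: e2 phi2].
  rewrite -subr_ge0 (_ : _ - _ = (3 - phi) * ((1 - t) * (t + 1 + phi))).
    by rewrite !mulr_ge0//; lra.
  by field: e2 phi2.
apply: (@same_orbit_trans _ _ _
  (point (e * ((4 - 3 * phi) / 2 + (phi - 3) / 2 * t)) (e * (3 - phi - t)))).
  apply: (@same_orbit_turn e); [by []| |by field: e2 phi2|by field: e2 phi2].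
  rewrite -subr_ge0 (_ : _ - _ = (3 - phi) * ((1 - t) * (t - 1 + phi))).
    by rewrite !mulr_ge0//; lra.
  by field: e2 phi2.
apply: (@same_orbit_turn (- e)); [by rewrite mulrNN| |by field: e2 phi2|by field: e2 phi2].
rewrite -subr_ge0 (_ : _ - _ = (3 - phi) * ((3 - t) * (t - 1 + phi))).
  by rewrite !mulr_ge0//; lra.
by field: e2 phi2.
Qed.

(** The word a b a b^2 for e = 1, and its mirror image b a b a^2 for e = -1: on
the smaller piece, the image under the first three letters stays in the disk
of the fourth, so that it can turn there twice. *)
Lemma same_orbit_short_shift (e t : R) : e * e = 1 -> 1 - phi <= t <= 3 - 2 * phi ->
  reach (segment (e * t)) (segment (e * (t + 2 * (phi - 1)))).
Proof.
move=> e2 /andP[t0 t1]; have /andP[phi0 phi1] := golden_ratio_bounds R.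
apply: same_orbit_trans; first by apply: same_orbit_three_turns => //; lra.
(* After the fourth turn the segment is vertical; at both ends of the piece the
   gap to the circle is 4 phi - 2, before and after this turn. *)
apply: (@same_orbit_trans _ _ _
  (point (e * ((3 - phi) / 2)) (e * (7 - 4 * phi + 2 * (phi - 1) * t)))).
  apply: (@same_orbit_turn e); [by []| |by field: e2 phi2|by field: e2 phi2].
  rewrite -subr_ge0
    (_ : _ - _ = (3 - phi) * ((t - 1 + phi) * (3 - 2 * phi - t)) + (4 * phi - 2)).
    by rewrite addr_ge0 ?mulr_ge0//; lra.
  by field: e2 phi2.
apply: (@same_orbit_turn e); [by []| |by field: e2 phi2|by field: e2 phi2].
rewrite -subr_ge0
  (_ : _ - _ = (3 - phi) * ((t - 1 + phi) * (3 - 2 * phi - t)) + (4 * phi - 2)).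
  by rewrite addr_ge0 ?mulr_ge0//; lra.
by field: e2 phi2.
Qed.

(** The part t <= 1 - phi is where the word for e = -1 arrives, so there the shift
is the inverse of that word. *)
Lemma same_orbit_shift_right (t : R) : -1 <= t <= 3 - 2 * phi ->
  reach (segment t) (segment (t + 2 * (phi - 1))).
Proof.
move=> /andP[t0 t1]; have /andP[phi0 phi1] := golden_ratio_bounds R.
have [t2|t2] := leP (1 - phi) t.
  by have := @same_orbit_short_shift 1 t; rewrite !mul1r; apply => //; lra.
apply: same_orbit_sym.
have := @same_orbit_short_shift (-1) (- (t + 2 * (phi - 1))).
rewrite !mulN1r !opprK (_ : - (- _ + _) = t); last by ring.
by apply => //; lra.
Qed.

(** The words a b a and b a b send the segment to the same line, where their
images of t E and of (t + 2 phi - 4) E agree. *)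
Lemma same_orbit_shift_left (t : R) : 3 - 2 * phi <= t <= 1 ->
  reach (segment t) (segment (t + 2 * (phi - 1) - 2)).
Proof.
move=> /andP[t0 t1]; have /andP[phi0 phi1] := golden_ratio_bounds R.
have := @same_orbit_three_turns 1 t; rewrite !mul1r => to_common.
(* The parameter for e = -1 is opposite to the position on the segment. *)
have := @same_orbit_three_turns (-1) (4 - 2 * phi - t); rewrite !mulN1r => from_common.
apply: same_orbit_trans (to_common _ _) _; [by []|lra|].
apply: same_orbit_sym.
rewrite (_ : t + _ - _ = - (4 - 2 * phi - t)); last by ring.
set p := point _ _; rewrite (_ : p = point
  (- ((3 * phi - 4) / 2 - (phi - 1 / 2) * (4 - 2 * phi - t)))
  (- (3 * phi - 5 + (2 - phi) * (4 - 2 * phi - t)))).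
  by apply: from_common; [rewrite opprK|lra].
by rewrite /p; congr point; field: phi2.
Qed.

(** Iterating the two shifts follows the multiples of 2 (phi - 1) around the
circle obtained from [-1, 1] by identifying its ends. *)
Lemma same_orbit_circle_rotation (n : nat) : exists2 m : int,
  -1 <= 2 * (n%:R * (phi - 1) - m%:~R) <= 1 &
  reach (segment 0) (segment (2 * (n%:R * (phi - 1) - m%:~R))).
Proof.
have /andP[phi0 phi1] := golden_ratio_bounds R.
elim: n => [|n [m]]; first (exists 0; rewrite mul0r subr0 mulr0;
  [lra | exact: same_orbit_refl]).
set t := 2 * _ => /andP[t0 t1] tO.
have [t2|t2] := leP t (3 - 2 * phi).
  have shift : 2 * (n.+1%:R * (phi - 1) - m%:~R) = t + 2 * (phi - 1).
    by rewrite /t -natr1; ring.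
  exists m; rewrite shift; first by lra.
  by apply: same_orbit_trans tO _; apply: same_orbit_shift_right; rewrite t0.
have shift :
    2 * (n.+1%:R * (phi - 1) - (m + 1)%:~R) = t + 2 * (phi - 1) - 2.
  by rewrite /t -natr1 intrD; ring.
exists (m + 1); rewrite shift; first by lra.
by apply: same_orbit_trans tO _; apply: same_orbit_shift_left; rewrite t1 ltW.
Qed.

Lemma segment_inj : injective segment.
Proof.
have /andP[phi0 phi1] := golden_ratio_bounds R.
move=> t t' [/(mulfI _) + _]; apply; lra.
Qed.

End Segment.

Theorem theorem2 (R : realType) :
  infinite_set (GG 5 (Num.sqrt (3 + golden_ratio : R))).
Proof.
have [m _ orbit_m] := all_sig2 (fun n => cid2 (@same_orbit_circle_rotation R n)).
apply: (infinite_orbit _ orbit_m) => i j /segment_inj ij.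
(* Equal positions give (i - j) (phi - 1) = m i - m j. *)
have : (i%:Z - j%:Z)%:~R * golden_ratio = (i%:Z - j%:Z + m i - m j)%:~R :> R.
  by rewrite !(intrD, intrB); lra.
by move/golden_ratio_irrational/eqP; rewrite subr_eq0 => /eqP[].
Qed.
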